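(* Let $\mathsf{Ag}=\{a,b\}$, $G=\{a,b\}$, and let $\mathcal{G}_3$, $\chi$ and $\rho$ be as described in the context. Let $\mathrm{I}$ be an information perspective in which agent $a$'s strategy is not common knowledge among $G$. Then $\mathcal{G}_3,(\chi,\mathrm{I},\rho)\nVdash\mathsf{C}_Gp$.
   Context: Fix a countable set $\mathsf{Prop}$ of atomic propositions containing $p,q$, and the set of agents $\mathsf{Ag}=\{a,b\}$. A concurrent game structure is a tuple $\mathcal{G}=(\mathsf{Ac},\mathsf{V},\mathsf{E},\ell,(\sim_c)_{c\in\mathsf{Ag}})$ where $\mathsf{Ac}$ is a finite set of actions, $\mathsf{V}$ a finite set of positions, $\mathsf{E}:\mathsf{V}\times\mathsf{Ac}^{\mathsf{Ag}}\to\mathsf{V}$ a transition function, $\ell:\mathsf{V}\to\mathcal{P}(\mathsf{Prop})$ a valuation, and each $\sim_c\subseteq(\mathsf{V}\times\mathsf{V})\cup(\mathsf{Ac}\times\mathsf{Ac})$ an equivalence relation. A joint action is a function $\gamma:\mathsf{Ag}\to\mathsf{Ac}$; $\gamma\sim_c\delta$ iff $\gamma(d)\sim_c\delta(d)$ for all $d$. A history is a sequence $\rho=v_0\gamma_1v_1\ldots\gamma_nv_n$ of positions and joint actions with $\mathsf{E}(v_i,\gamma_{i+1})=v_{i+1}$; $\rho_{\le i}=v_0\gamma_1\ldots\gamma_iv_i$, $\mathsf{last}(\rho)=v_n$; $\mathsf{Hist}$ is the set of histories. $\rho\sim_c\rho'$ iff they have the same number $n$ of joint actions, their $i$-th positions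 are $\sim_c$-related ($i\le n$) and their $i$-th joint actions are $\sim_c$-related ($1\le i\le n$). A strategy is a function $\mathsf{Hist}\to\mathsf{Ac}$; an assignment is a function from $\mathsf{Ag}$ to strategies. $\rho$ is consistent with $\chi$ for $X\subseteq\mathsf{Ag}$ if $\gamma_{i+1}(d)=\chi(d)(\rho_{\le i})$ for all $i<n$, $d\in X$. The one-step continuation is $\mathsf{X}^\chi_{\mathcal G}\rho=\rho\,\gamma_{n+1}v_{n+1}$ with $\gamma_{n+1}(d)=\chi(d)(\rho)$ and $v_{n+1}=\mathsf{E}(v_n,\gamma_{n+1})$. $\mathsf{Ag}^*$ is the set of finite words over $\mathsf{Ag}$ with no two equal adjacent letters; $\mathsf{Ag}^{\ge n}$ those of length $\ge n$, and similarly $G^{\ge n}$ for words over $G$; $cw$ denotes $w$ prefixed by $c$. An information perspective is a set $\mathrm{I}\subseteq\mathsf{Ag}^{\ge2}$; $\mathrm{I}_c=\{d: cd\in\mathrm{I}\}\cup\{c\}$; $\mathrm{I}[c]=\{w\in\mathsf{Ag}^{\ge2}: cw\in\mathrm{I}\}\cup\{w\in\mathrm{I}: w=cw'\text{ for some }w'\in\mathsf{Ag}^*\}$. Agent $a$'s strategy is common knowledge among $G$ in $\mathrm{I}$ if $wa\in\mathrm{I}$ for every $w\in G^{\ge1}$ such that $wa$ has no two equal adjacent letters (i.e. $ba,aba,baba,\ldots\in\mathrm{I}$). $\chi\sim^{\mathrm{I}}_c\chi'$ iff $\chi(d)=\chi'(d)$ for all $d\in\mathrm{I}_c$. A state is a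 triple $(\chi,\mathrm{I},\rho)$; it is $c$-consistent if $\rho$ is consistent with $\chi$ for $\mathrm{I}_c$. $(\chi,\mathrm{I},\rho)\trianglelefteq_c(\chi',\mathrm{I}',\rho')$ iff $\chi\sim^{\mathrm{I}}_c\chi'$, $\mathrm{I}[c]\subseteq\mathrm{I}'$, $\rho\sim_c\rho'$, and both states are $c$-consistent. $Z\trianglelefteq_GZ'$ iff $Z\trianglelefteq_cZ'$ for some $c\in G$; $\trianglelefteq^*_G$ is its transitive closure. Truth: $\mathcal{G},(\chi,\mathrm{I},\rho)\Vdash p$ iff $p\in\ell(\mathsf{last}(\rho))$; $\mathcal{G},Z\Vdash\mathsf{C}_G\phi$ iff $\mathcal{G},Z'\Vdash\phi$ for all $Z'$ with $Z\trianglelefteq^*_GZ'$ (and $\mathsf{K}_c$ via $\trianglelefteq_c$, $\mathsf{X}$ via one-step continuation, Boolean connectives classically). The structure $\mathcal{G}_3$: positions $v_1,v_2,v_3$; actions $\mathsf{Ac}=\{\alpha,\beta\}$; $\mathsf{E}(v_1,\gamma)=v_2$ if $\gamma(a)=\alpha$ and $=v_3$ if $\gamma(a)=\beta$; $\mathsf{E}(v_2,\gamma)=v_2$, $\mathsf{E}(v_3,\gamma)=v_3$ for all $\gamma$; $\ell(v_1)=\emptyset$, $\ell(v_2)=\{p\}$, $\ell(v_3)=\{q\}$. Agent $a$ distinguishes all positions and both actions ($\sim_a$ is equality); for agent $b$, $v_2\sim_bv_3$ and $\alpha\sim_b\beta$, while $v_1$ is $\sim_b$-related only to itself. $\chi$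 is an assignment with $\chi(a)(v_1)=\alpha$ (here $v_1$ is the history of length zero), and $\rho=v_1\gamma_1v_2$ where $\gamma_1(a)=\alpha$ and $\gamma_1(b)=\chi(b)(v_1)$. *)

(* Defs.v *)
From HB Require Import structures.
From Stdlib Require Export Relation_Operators.
From mathcomp Require Export all_boot.

Set Implicit Arguments.
Unset Strict Implicit.
Unset Printing Implicit Defensive.

Inductive agent := agA | agB.

Definition bool_of_agent c := if c is agA then true else false.
Definition agent_of_bool (x : bool) := if x then agA else agB.
Lemma bool_of_agentK : cancel bool_of_agent agent_of_bool.
Proof. by case. Qed.
HB.instance Definition _ := Countable.copy agent (can_type bool_of_agentK).
HB.instance Definition _ : isFinite agent := CanIsFinite bool_of_agentK.

(* The relation ~_c on the disjoint union of V and Ac relates no position to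
   an action, so it is given by its restrictions cgs_posrel and cgs_actrel. *)
Record cgs (AP : countType) := CGS {
  cgs_act : finType;
  cgs_pos : finType;
  cgs_trans : cgs_pos -> {ffun agent -> cgs_act} -> cgs_pos;
  cgs_val : cgs_pos -> AP -> Prop;
  cgs_posrel : agent -> rel cgs_pos;
  cgs_actrel : agent -> rel cgs_act;
  cgs_posrelP : forall c, equivalence_rel (cgs_posrel c);
  cgs_actrelP : forall c, equivalence_rel (cgs_actrel c) }.

Notation joint_action G := {ffun agent -> cgs_act G}.

Section Histories.

Variables (AP : countType) (G : cgs AP).

Fixpoint valid_steps (v : cgs_pos G) (s : seq (joint_action G * cgs_pos G)) :=
  if s is (g, w) :: s' then (cgs_trans v g == w) && valid_steps w s' else true.

(* v_0 g_1 v_1 ... g_n v_n is stored as v_0 and [:: (g_1, v_1); ...; (g_n, v_n)]. *)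
Record history := History {
  hstart : cgs_pos G;
  hsteps : seq (joint_action G * cgs_pos G);
  hvalid : valid_steps hstart hsteps }.

Definition hpositions (h : history) := hstart h :: map snd (hsteps h).
Definition hactions (h : history) := map fst (hsteps h).
Definition hlast (h : history) := last (hstart h) (map snd (hsteps h)).

Definition hist0 (v : cgs_pos G) : history := @History v [::] isT.

Lemma valid_steps_take v s i : valid_steps v s -> valid_steps v (take i s).
Proof.
by elim: s v i => [|[g w] s IHs] v [|i] //= /andP[-> /IHs ->].
Qed.

Definition hprefix (h : history) (i : nat) : history :=
  History (valid_steps_take i (hvalid h)).

Definition strategy := history -> cgs_act G.
Definition assignment := agent -> strategy.

Lemma valid_steps_rcons v s g : valid_steps v s ->
  valid_steps v (rcons s (g, cgs_trans (last v (map snd s)) g)).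
Proof.
elim: s v => [|[k w] s IHs] v /=; first by rewrite eqxx.
by move=> /andP[-> /IHs].
Qed.

Definition hnext (chi : assignment) (h : history) : history :=
  History (valid_steps_rcons [ffun d => chi d h] (hvalid h)).

Definition jact_rel (c : agent) : rel (joint_action G) :=
  fun g k => [forall d, cgs_actrel c (g d) (k d)].

(* all2 also checks that the two sequences have the same size. *)
Definition hist_rel (c : agent) (h k : history) : bool :=
  all2 (@cgs_posrel _ G c) (hpositions h) (hpositions k)
  && all2 (jact_rel c) (hactions h) (hactions k).

(* onth is indexed from 0, so that item i of hactions h is g_(i+1). *)
Definition consistent (chi : assignment) (X : agent -> Prop) (h : history) :=
  forall i g, onth (hactions h) i = Some g ->
  forall d, X d -> g d = chi d (hprefix h i).

End Histories.

(* Words over A of length >= n with no two equal adjacent letters. *)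
Definition words_ge (A : {set agent}) (n : nat) (w : seq agent) : bool :=
  [&& all (mem A) w, sorted (fun c d => c != d) w & n <= size w].

Record perspective := Perspective {
  pwords :> seq agent -> Prop;
  pwordsP : forall w, pwords w -> words_ge [set: agent] 2 w }.

(* I_c *)
Definition known_agents (I : perspective) (c d : agent) : Prop :=
  I [:: c; d] \/ d = c.

(* I[c] *)
Definition subjective (I : perspective) (c : agent) (w : seq agent) : Prop :=
  (words_ge [set: agent] 2 w /\ I (c :: w))
  \/ (I w /\ exists2 w', words_ge [set: agent] 0 w' & w = c :: w').

Definition common_knowledge_strategy
    (I : perspective) (A : {set agent}) (c : agent) : Prop :=
  forall w, words_ge A 1 w -> words_ge [set: agent] 0 (rcons w c) ->
  I (rcons w c).

Inductive formula (AP : countType) :=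
  | Atom of AP
  | Not of formula AP
  | And of formula AP & formula AP
  | Next of formula AP
  | Know of agent & formula AP
  | CommonKnow of {set agent} & formula AP.

Section Semantics.

Variables (AP : countType) (G : cgs AP).

Record state := State {
  st_assign : assignment G;
  st_persp : perspective;
  st_hist : history G }.

Definition assign_rel (I : perspective) (c : agent) (chi chi' : assignment G) :=
  forall d, known_agents I c d -> chi d = chi' d.

Definition state_consistent (c : agent) (Z : state) : Prop :=
  consistent (st_assign Z) (known_agents (st_persp Z) c) (st_hist Z).

Definition state_rel (c : agent) (Z Z' : state) : Prop :=
  [/\ assign_rel (st_persp Z) c (st_assign Z) (st_assign Z'),
      forall w, subjective (st_persp Z) c w -> st_persp Z' w,
      hist_rel c (st_hist Z) (st_hist Z'),
      state_consistent c Z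
    & state_consistent c Z'].

Definition group_rel (A : {set agent}) (Z Z' : state) : Prop :=
  exists2 c, c \in A & state_rel c Z Z'.

Fixpoint sat (Z : state) (phi : formula AP) : Prop :=
  match phi with
  | Atom x => cgs_val (hlast (st_hist Z)) x
  | Not psi => ~ sat Z psi
  | And psi1 psi2 => sat Z psi1 /\ sat Z psi2
  | Next psi =>
      sat (State (st_assign Z) (st_persp Z) (hnext (st_assign Z) (st_hist Z)))
          psi
  | Know c psi => forall Z', state_rel c Z Z' -> sat Z' psi
  | CommonKnow A psi =>
      forall Z', clos_trans state (group_rel A) Z Z' -> sat Z' psi
  end.

End Semantics.

Inductive act3 := alpha | beta.

Definition bool_of_act3 x := if x is alpha then true else false.
Definition act3_of_bool (x : bool) := if x then alpha else beta.
Lemma bool_of_act3K : cancel bool_of_act3 act3_of_bool.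
Proof. by case. Qed.
HB.instance Definition _ := Countable.copy act3 (can_type bool_of_act3K).
HB.instance Definition _ : isFinite act3 := CanIsFinite bool_of_act3K.

Inductive pos3 := v1 | v2 | v3.

Definition code_pos3 v : option bool :=
  match v with v1 => None | v2 => Some true | v3 => Some false end.
Definition decode_pos3 (x : option bool) :=
  match x with None => v1 | Some true => v2 | Some false => v3 end.
Lemma code_pos3K : cancel code_pos3 decode_pos3.
Proof. by case. Qed.
HB.instance Definition _ := Countable.copy pos3 (can_type code_pos3K).
HB.instance Definition _ : isFinite pos3 := CanIsFinite code_pos3K.

Definition trans3 (v : pos3) (g : {ffun agent -> act3}) : pos3 :=
  match v with
  | v1 => match g agA with alpha => v2 | beta => v3 end
  | v2 => v2
  | v3 => v3
  end.

Definition val3 (AP : countType) (p q : AP) (v : pos3) (x : AP) : Prop :=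
  match v with v1 => False | v2 => x = p | v3 => x = q end.

Definition posrel3 (c : agent) : rel pos3 :=
  match c with
  | agA => fun v w => v == w
  | agB => fun v w =>
      (v == w) || (v \in [:: v2; v3]) && (w \in [:: v2; v3])
  end.

Definition actrel3 (c : agent) : rel act3 :=
  match c with
  | agA => fun x y => x == y
  | agB => fun _ _ => true
  end.

Lemma posrel3P c : equivalence_rel (posrel3 c).
Proof. by case: c => -[] [] []. Qed.

Lemma actrel3P c : equivalence_rel (actrel3 c).
Proof. by case: c => -[] [] []. Qed.

Definition G3 (AP : countType) (p q : AP) : cgs AP :=
  CGS trans3 (val3 p q) posrel3P actrel3P.

(* Main.v *)
Require Import Defs.
From Stdlib Require Import Classical Operators_Properties.

Set Implicit Arguments.
Unset Strict Implicit.
Unset Printing Implicit Defensive.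

(** If the word [c :: u] is missing from the perspective [I] and [u] does not
    start with [c], then [u] is missing from [I[c]].  As [rho] is consistent
    with [chi] for every agent, keeping [chi] and [rho] while passing from [I]
    to [I[c]] is a step for [c].  Consuming a missing word [w a] letter by
    letter thus leads to a perspective without [b a], in which [b] does not know
    the strategy of [a]; a last step for [b] then replaces the first action of [a]
    by [beta] and ends in [v3], where [p] fails. *)

(** Validity is a Boolean equation, so its proofs are unique. *)
Lemma history_inj (AP : countType) (G : cgs AP) (h k : history G) :
  hstart h = hstart k -> hsteps h = hsteps k -> h = k.
Proof.
case: h k => [v s hs] [w t ht] /= ev es; rewrite -ev -es in ht *.
by rewrite (bool_irrelevance hs ht).
Qed.

Lemma hprefix0 (AP : countType) (G : cgs AP) (h : history G) :
  hprefix h 0 = hist0 (hstart h).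
Proof. by apply: history_inj => //=; rewrite take0. Qed.

Lemma consistent_size1 (AP : countType) (G : cgs AP) (chi : assignment G)
    (X : agent -> Prop) (h : history G) (g : joint_action G) (v : cgs_pos G) :
  hsteps h = [:: (g, v)] -> (forall d, X d -> g d = chi d (hist0 (hstart h))) ->
  consistent chi X h.
Proof.
move=> hs gP i k; rewrite /hactions hs.
case: i => [|[|i]] //= [<-] d Xd.
by rewrite hprefix0 gP.
Qed.

Lemma consistent_sub (AP : countType) (G : cgs AP) (chi : assignment G)
    (X Y : agent -> Prop) (h : history G) :
  (forall d, X d -> Y d) -> consistent chi Y h -> consistent chi X h.
Proof. by move=> XY hY i g ig d /XY; apply: hY. Qed.

Lemma hist_rel_refl (AP : countType) (G : cgs AP) (c : agent) (h : history G) :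
  hist_rel c h h.
Proof.
have all2_refl T (r : rel T) s : (forall x, r x x) -> all2 r s s.
  by move=> rr; elim: s => //= x s ->; rewrite rr.
rewrite /hist_rel !all2_refl // => [g|v].
  by apply/forallP => d; have [] := cgs_actrelP c (g d) (g d) (g d).
by have [] := cgs_posrelP c v v v.
Qed.

Lemma subjective_words (I : perspective) (c : agent) (w : seq agent) :
  subjective I c w -> words_ge [set: agent] 2 w.
Proof. by case=> -[] // /pwordsP. Qed.

Definition subj_persp (I : perspective) (c : agent) : perspective :=
  Perspective (@subjective_words I c).

(** A word enters [I[c]] either because prefixing [c] gives a word of [I], which [~ I [:: c, d & u]]
    excludes, or because it starts with [c] itself, which [c != d] excludes. *)
Lemma subj_perspN (I : perspective) (c d : agent) (u : seq agent) :
  c != d -> ~ I [:: c, d & u] -> ~ subj_persp I c (d :: u).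
Proof.
move=> ncd nI [[_ /nI]//|[_ [w' _ [edc _]]]].
by rewrite edc eqxx in ncd.
Qed.

Lemma state_rel_subj_persp (AP : countType) (G : cgs AP) (chi : assignment G)
    (I : perspective) (h : history G) (c : agent) :
  consistent chi (fun=> True) h ->
  state_rel c (State chi I h) (State chi (subj_persp I c) h).
Proof.
move=> hc; split => //; first exact: hist_rel_refl.
- exact: consistent_sub hc.
- exact: consistent_sub hc.
Qed.

(** Induction on [w] for all [I] at once, since each letter consumed changes the perspective. The
    closure is reflexive because [w] may be the single letter [agB]. *)
Lemma reach_perspN (AP : countType) (G : cgs AP) (chi : assignment G)
    (h : history G) (A : {set agent}) (w : seq agent) (I : perspective) :
  consistent chi (fun=> True) h -> words_ge A 1 w ->
  words_ge [set: agent] 0 (rcons w agA) -> ~ I (rcons w agA) ->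
  exists2 J : perspective, ~ J [:: agB; agA] &
    clos_refl_trans _ (group_rel A) (State chi I h) (State chi J h).
Proof.
move=> hc; elim: w I => [|c [|d w] IHw] I.
- by rewrite /words_ge andbF.
(* The letter [agA] would give the word [aa], which has equal neighbours. *)
- case: c => _ // wa nI; first by case/and3P: wa.
  by exists I => //; exact: rt_refl.
- move=> /and3P[/= /andP[cA Aw] /andP[ncd sw] _].
  move=> /and3P[/= /andP[_ Tw] /andP[_ sw'] _] nI.
  have [||| J nJ IJ] := IHw (subj_persp I c).
  + by apply/and3P; split.
  + by apply/and3P; split.
  + exact: subj_perspN nI.
  + exists J => //; apply: rt_trans IJ; apply: rt_step.
    by exists c => //; exact: state_rel_subj_persp.
Qed.

(** Agent [b] confuses [v2] with [v3] and [alpha] with [beta], so only consistency could rule the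
    deviation out, and without [ba] it constrains no action but that of [b]. *)
Lemma state_rel_deviate (AP : countType) (p q : AP) (chi : assignment (G3 p q))
    (rho : history (G3 p q)) (gamma : joint_action (G3 p q)) (J : perspective) :
  hstart rho = v1 -> hsteps rho = [:: (gamma, v2 : cgs_pos (G3 p q))] ->
  gamma agB = chi agB (hist0 (v1 : cgs_pos (G3 p q))) -> ~ J [:: agB; agA] ->
  exists2 Z : state (G3 p q), hlast (st_hist Z) = v3 &
    state_rel agB (State chi J rho) Z.
Proof.
move=> rho0 rho1 gammab nJ.
(* The action of [b] is kept, as [b] knows its own strategy. *)
pose g : joint_action (G3 p q) :=
  [ffun d => if d is agA then beta else gamma agB].
have g_valid :
    valid_steps (v1 : cgs_pos (G3 p q)) [:: (g, v3 : cgs_pos (G3 p q))].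
  by rewrite /= ffunE eqxx.
have known_b (K : perspective) d :
    ~ K [:: agB; agA] -> known_agents K agB d -> d = agB.
  by move=> nK; case: d => // -[].
exists (State chi (subj_persp J agB) (History g_valid)) => //.
split => //=.
- rewrite /hist_rel /hpositions /hactions rho0 rho1 /= andbT.
  by apply/forallP.
- apply: (consistent_size1 (g := gamma) (v := v2 : cgs_pos (G3 p q))) => //= d.
  by rewrite rho0 => /(known_b _ _ nJ) ->.
- apply: (consistent_size1 (g := g) (v := v3 : cgs_pos (G3 p q))) => //= d.
  (* The word [ba] could only come from [bba], which is not a legal word, or from [ba] in [J]. *)
  have nK : ~ subj_persp J agB [:: agB; agA]
    by case=> [[_ /pwordsP/and3P[]]|[/nJ]].
  by move=> /(known_b _ _ nK) ->; rewrite ffunE.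
Qed.

Theorem theorem1 (AP : countType) (p q : AP) (neq_pq : p <> q)
    (chi : assignment (G3 p q))
    (chi_v1 : chi agA (hist0 (v1 : cgs_pos (G3 p q))) = alpha)
    (gamma1 : joint_action (G3 p q))
    (gamma1_a : gamma1 agA = alpha)
    (gamma1_b : gamma1 agB = chi agB (hist0 (v1 : cgs_pos (G3 p q))))
    (rho : history (G3 p q))
    (rho_start : hstart rho = v1)
    (rho_steps : hsteps rho = [:: (gamma1, v2 : cgs_pos (G3 p q))])
    (I : perspective)
    (not_ck : ~ common_knowledge_strategy I [set agA; agB] agA) :
  ~ sat (State chi I rho) (CommonKnow [set agA; agB] (Atom p)).
Proof.
move=> /= Cp; apply: not_ck => w wA wa; apply: NNPP => nI.
have rho_c : consistent chi (fun=> True) rho.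
  apply: (consistent_size1 (g := gamma1) rho_steps) => d _.
  by rewrite rho_start; case: d => //; rewrite gamma1_a chi_v1.
have [J nJ IJ] := reach_perspN rho_c wA wa nI.
have [Z Zv3 JZ] := state_rel_deviate rho_start rho_steps gamma1_b nJ.
(* At [v3] the atom [p] holds only if [p = q]. *)
have := Cp Z; rewrite Zv3 => Zp; apply: neq_pq; apply: Zp.
by apply: clos_rt_t IJ _; apply: t_step; exists agB => //; rewrite !inE.
Qed.
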